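(* Let $\mathcal{K}$ be a $d$-dimensional cubical pseudomanifold with $d \geq 2$. Then the number of vertices of $\mathcal{K}$ satisfies $f_0(\mathcal{K}) \geq 2^{d+1}$.
   Context: A cubical complex $\mathcal{K}$ on a finite vertex set $V$ is a collection of subsets of $V$, partially ordered by inclusion, such that: $\emptyset\in\mathcal{K}$; $\{v\}\in\mathcal{K}$ for every $v\in V$; for every nonempty $F\in\mathcal{K}$ the interval $[\emptyset,F]=\{G\in\mathcal{K}:G\subseteq F\}$ is isomorphic to the face poset of a cube of some dimension $k$ (then $F$ is a $k$-dimensional face); and $F\cap G\in\mathcal{K}$ whenever $F,G\in\mathcal{K}$. $\mathcal{K}$ is pure of dimension $d$ if all its maximal faces (facets) have dimension $d$. A pure $d$-dimensional cubical complex is a pseudomanifold if each $(d-1)$-dimensional face (ridge) is contained in exactly two facets. $f_0(\mathcal{K})$ is the number of vertices. *)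

(* Defs.v *)
From mathcomp Require Import all_boot.
Set Implicit Arguments.
Unset Strict Implicit.
Unset Printing Implicit Defensive.

(* Isomorphism of two finite families of finite sets, as posets under
   inclusion; injectivity of f on A follows from the order being reflected. *)
Definition poset_iso (T U : finType) (A : {set {set T}}) (B : {set {set U}}) :=
  exists f : {set T} -> {set U},
    f @: A = B /\ {in A &, {mono f : X Y / X \subset Y}}.

(* Each face of the cube [0, 1]^k is identified with its set of vertices in
   {0, 1}^k: a nonempty face is obtained by prescribing the coordinates in
   some I (I empty gives the whole cube), and the empty face is included. *)
Definition cube_faces (k : nat) : {set {set {ffun 'I_k -> bool}}} :=
  set0 |: [set [set x : {ffun 'I_k -> bool} | [forall i in I, x i == a i]]
            | I : {set 'I_k}, a : {ffun 'I_k -> bool}].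

Definition face_interval (V : finType) (K : {set {set V}}) (F : {set V}) :
  {set {set V}} := [set G in K | G \subset F].

Definition face_of_dim (V : finType) (K : {set {set V}}) (k : nat)
    (F : {set V}) : Prop :=
  [/\ F \in K, F != set0 & poset_iso (face_interval K F) (cube_faces k)].

Record cubical_complex (V : finType) := CubicalComplex {
  faces :> {set {set V}};
  empty_face : set0 \in faces;
  vertex_face : forall v : V, [set v] \in faces;
  cube_face : forall F : {set V}, F \in faces -> F != set0 ->
    exists k : nat, face_of_dim faces k F;
  meet_face : forall F G : {set V}, F \in faces -> G \in faces ->
    F :&: G \in faces
}.

Definition facets (V : finType) (K : cubical_complex V) : {set {set V}} :=
  [set F | maxset (fun G : {set V} => G \in faces K) F].

Definition pure_of_dim (V : finType) (K : cubical_complex V) (d : nat) : Prop :=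
  forall F : {set V}, F \in facets K -> face_of_dim K d F.

(* Ridges are the faces of dimension d - 1; d.-1 is the intended value only
   for 0 < d. *)
Definition cubical_pseudomanifold (V : finType) (K : cubical_complex V)
    (d : nat) : Prop :=
  pure_of_dim K d /\
  forall R : {set V}, face_of_dim K d.-1 R ->
    #|[set F in facets K | R \subset F]| = 2.

(* Main.v *)
Require Import Defs.
From mathcomp Require Import all_boot.
From mathcomp Require Import zify.

Set Implicit Arguments.
Unset Strict Implicit.
Unset Printing Implicit Defensive.

(** Two disjoint facets already have 2^(d+1) vertices.  If two facets F and H
    meet in a nonempty face S that is not a ridge, then H has a ridge Q
    containing S; the other facet N through Q satisfies N :&: H = Q, and
    inclusion-exclusion gives N at least |S| vertices outside F :|: H, which
    is what F :|: H lacks.  Otherwise any two facets meet in a ridge.  Then let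
    G0, G1 be the neighbours of F across opposite ridges R0, R1, and N the
    neighbour across a ridge Q of F meeting both R0 and R1.  The faces
    N :&: F, N :&: G0 and N :&: G1 of the cube N meet pairwise but have no
    common vertex, contradicting the Helly property of faces of a cube. *)

(** * Faces of the standard cube *)

Definition half_cube (k : nat) (i : 'I_k) (b : bool) :
  {set {ffun 'I_k -> bool}} := [set x : {ffun 'I_k -> bool} | x i == b].

Lemma cube_faceP (k : nat) (C : {set {ffun 'I_k -> bool}}) :
  reflect (C = set0 \/ exists I : {set 'I_k}, exists a : {ffun 'I_k -> bool},
             C = [set x : {ffun 'I_k -> bool} | [forall i in I, x i == a i]])
          (C \in cube_faces k).
Proof.
rewrite !inE; apply: (iffP orP).
  by case=> [/eqP->|/imset2P[I a _ _ ->]]; [left | right; exists I, a].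
by case=> [->|[I [a ->]]]; [left | right; apply/imset2P; exists I a].
Qed.

Lemma set1_cube_face (k : nat) (x : {ffun 'I_k -> bool}) :
  [set x] \in cube_faces k.
Proof.
apply/cube_faceP; right; exists setT, x; apply/setP => y; rewrite !inE.
apply/eqP/forall_inP => [-> //|xy].
by apply/ffunP => i; apply/eqP/xy; rewrite inE.
Qed.

Lemma setT_cube_face (k : nat) : setT \in cube_faces k.
Proof.
apply/cube_faceP; right; exists set0, [ffun=> true]; apply/setP => y.
by rewrite !inE; symmetry; apply/forall_inP => i; rewrite inE.
Qed.

Lemma half_cube_face (k : nat) (i : 'I_k) (b : bool) :
  half_cube i b \in cube_faces k.
Proof.
apply/cube_faceP; right; exists [set i], [ffun=> b]; apply/setP => y.
rewrite !inE; apply/idP/forall_inP => [yi j /set1P->|/(_ i)]; rewrite ffunE //.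
by apply; rewrite inE.
Qed.

Lemma card_half_cube (k : nat) (i : 'I_k.+1) (b : bool) :
  #|half_cube i b| = 2 ^ k.
Proof.
have eq_halves : #|half_cube i true| = #|half_cube i false|.
  (* Reversing coordinate [i] is an involution that swaps the two halves. *)
  pose flip (x : {ffun 'I_k.+1 -> bool}) := [ffun j => (j == i) (+) x j].
  have flipK : involutive flip.
    by move=> x; apply/ffunP => j; rewrite !ffunE addKb.
  rewrite -(card_imset _ (inv_inj flipK)); apply: eq_card => x.
  rewrite -[x in LHS]flipK mem_imset; last exact: inv_inj.
  by rewrite !inE ffunE eqxx; case: (x i).
have := cardsC (half_cube i true); rewrite card_ffun card_bool card_ord.
have -> : ~: half_cube i true = half_cube i false.
  by apply/setP => x; rewrite !inE; case: (x i).
rewrite eq_halves expnS mul2n -addnn; case: b; rewrite ?eq_halves; lia.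
Qed.

(** A face other than the whole cube prescribes at least one coordinate. *)
Lemma cube_face_sub_half (k : nat) (C : {set {ffun 'I_k -> bool}}) :
  C \in cube_faces k -> C != set0 -> C != setT ->
  exists i, exists b, C \subset half_cube i b.
Proof.
case/cube_faceP => [->|[I [a ->]] _ CnT]; first by rewrite eqxx.
have [I0|[i iI]] := set_0Vmem I.
  case/eqP: CnT; apply/setP => x; rewrite !inE.
  by apply/forall_inP => i; rewrite I0 inE.
exists i, (a i); apply/subsetP => x; rewrite !inE => /forall_inP; exact.
Qed.

(** The coordinatewise median: where [x] and [y] differ, [z] agrees with one of them and decides. *)
Definition majority (k : nat) (x y z : {ffun 'I_k -> bool}) :
  {ffun 'I_k -> bool} := [ffun i => if x i == y i then x i else z i].

Lemma majority_cube_face (k : nat) (C : {set {ffun 'I_k -> bool}}) x y z :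
  C \in cube_faces k ->
  [|| (x \in C) && (y \in C), (x \in C) && (z \in C)
    | (y \in C) && (z \in C)] ->
  majority x y z \in C.
Proof.
case/cube_faceP => [->|[I [a ->]]]; rewrite !inE // => two.
apply/forall_inP => i iI; rewrite ffunE.
case/or3P: two => /andP[/forall_inP/(_ i iI)/eqP-> /forall_inP/(_ i iI)/eqP->].
- by rewrite eqxx.
- by case: ifP.
- by case: ifP => // /eqP->.
Qed.

(** * Coordinates on the faces of a cubical complex *)

Section Faces.

Variables (V : finType) (K : cubical_complex V).
Implicit Types F G H R S : {set V}.

(* The vertices of a face can be read off the poset isomorphism as atoms. *)
Lemma face_coordinates k F : face_of_dim K k F ->
  exists h : V -> {ffun 'I_k -> bool},
    [/\ {in F &, injective h}, h @: F = setT,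
        forall C, C \in cube_faces k -> F :&: h @^-1: C \in faces K &
        forall G, G \in faces K -> G \subset F -> h @: G \in cube_faces k].
Proof.
case=> FK Fn0 [f [fim fmono]].
have memI G : (G \in face_interval K F) = (G \in faces K) && (G \subset F).
  by rewrite inE.
have I1 v : v \in F -> [set v] \in face_interval K F.
  by move=> vF; rewrite memI vertex_face sub1set.
have I0 : set0 \in face_interval K F by rewrite memI empty_face sub0set.
have f_face G : G \in face_interval K F -> f G \in cube_faces k.
  by rewrite -fim; apply: imset_f.
have f0 : f set0 = set0.
  have : set0 \in cube_faces k by rewrite !inE eqxx.
  rewrite -fim => /imsetP[Y YI Y0]; apply/eqP; rewrite -subset0.
  apply: (subset_trans (_ : f set0 \subset f Y)); last by rewrite -Y0.
  by rewrite fmono // sub0set.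
(* A singleton inside [f [set v]] is the image of some [Y] contained in [[set v]], and [Y] is not
   empty because [f] sends [set0] to [set0]. *)
have f1 v : v \in F -> exists x, f [set v] == [set x].
  move=> vF; have [fv0|[x xfv]] := set_0Vmem (f [set v]).
    have := fmono _ _ (I1 v vF) I0; rewrite f0 fv0 subxx subset0.
    by move/esym/eqP/setP/(_ v); rewrite !inE eqxx.
  have := set1_cube_face x; rewrite -fim => /imsetP[Y YI xE].
  have : Y \subset [set v] by rewrite -fmono ?I1 // -xE sub1set.
  rewrite subset1 => /orP[/eqP Yv|/eqP Y0].
    by exists x; rewrite xE Yv.
  by move: xE; rewrite Y0 f0 => /setP/(_ x); rewrite !inE eqxx.
(* The default point is taken only outside [F]. *)
pose h v := odflt [ffun=> true] [pick x | f [set v] == [set x]].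
have hE v : v \in F -> f [set v] = [set h v].
  move=> vF; rewrite /h; case: pickP => [x /eqP //|none].
  by have [x] := f1 v vF; rewrite none.
have fE G : G \in face_interval K F -> f G = h @: G.
  move=> GI; have GF : G \subset F by move: GI; rewrite memI => /andP[].
  apply/setP => x; apply/idP/imsetP => [xG|[v vG ->]].
    have := set1_cube_face x; rewrite -fim => /imsetP[Y YI xE].
    have YG : Y \subset G by rewrite -fmono // -xE sub1set.
    have [Y0|[v vY]] := set_0Vmem Y.
      by move: xE; rewrite Y0 f0 => /setP/(_ x); rewrite !inE eqxx.
    have vG := subsetP YG v vY; have vF := subsetP GF v vG.
    exists v => //; apply/esym/set1P; rewrite xE -sub1set -hE //.
    by rewrite fmono ?I1 // sub1set.
  have vF := subsetP GF v vG.
  by rewrite -sub1set -hE // fmono ?I1 // sub1set.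
have hinj : {in F &, injective h}.
  move=> u v uF vF huv; apply/set1P; rewrite -sub1set -fmono ?I1 //.
  by rewrite !hE // huv.
exists h; split=> // [|C|G GK GF]; last by rewrite -fE ?f_face // memI GK.
  apply/eqP; rewrite -subTset; have := setT_cube_face k.
  rewrite -fim => /imsetP[Y YI ->]; rewrite fE // imsetS //.
  by move: YI; rewrite memI => /andP[].
rewrite -fim => /imsetP[Y YI ->]; rewrite fE //.
move: YI; rewrite memI => /andP[YK YF].
suff -> : F :&: h @^-1: (h @: Y) = Y by [].
apply/setP => v; rewrite !inE; apply/andP/idP => [[vF /imsetP[u uY huv]]|vY].
  by rewrite (hinj v u) // (subsetP YF).
by rewrite (subsetP YF) // imset_f.
Qed.

Lemma card_face k F : face_of_dim K k F -> #|F| = 2 ^ k.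
Proof.
case/face_coordinates => h [hinj hF _ _].
by rewrite -(card_in_imset hinj) hF cardsT card_ffun card_bool card_ord.
Qed.

(** Since [2 ^ k] determines [k], the dimension of a face can be recognised by counting vertices. *)
Lemma face_of_dim_card k F : F \in faces K -> #|F| = 2 ^ k -> face_of_dim K k F.
Proof.
move=> FK cF; have Fn0 : F != set0 by rewrite -card_gt0 cF expn_gt0.
have [m Fm] := cube_face FK Fn0; move: (card_face Fm); rewrite cF.
by move/eqP; rewrite eqn_exp2l // => /eqP ->.
Qed.

Lemma half_face_of_dim k F (h : V -> {ffun 'I_k.+1 -> bool}) i b :
  {in F &, injective h} -> h @: F = setT ->
  F :&: h @^-1: half_cube i b \in faces K ->
  face_of_dim K k (F :&: h @^-1: half_cube i b).
Proof.
move=> hinj hF RK; apply: face_of_dim_card => //.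
rewrite -(card_half_cube i b) -(@card_in_imset _ _ h); last first.
  by move=> u v /setIP[uF _] /setIP[vF _]; apply: hinj.
congr #|pred_of_set _|; apply/setP => x.
apply/imsetP/idP => [[v /setIP[_]]|xC]; first by rewrite inE => vC ->.
have /imsetP[v vF xE] : x \in h @: F by rewrite hF inE.
by exists v; rewrite // inE vF inE -xE.
Qed.

(** In coordinates a proper face lies in a half cube, which pulls back to a ridge of [F]. *)
Lemma proper_face_sub_ridge k F S :
  face_of_dim K k.+1 F -> S \in faces K -> S != set0 -> S \proper F ->
  exists R, [/\ face_of_dim K k R, S \subset R & R \subset F].
Proof.
move=> Fk SK Sn0 /properP[SF [w wF wS]].
have [h [hinj hF hC hG]] := face_coordinates Fk.
have [||i [b Sib]] := cube_face_sub_half (hG S SK SF).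
- by rewrite imset_eq0.
- apply/eqP => /setP/(_ (h w)); rewrite inE => /imsetP[v vS hwv].
  by move: wS; rewrite (hinj w v) ?vS // (subsetP SF).
exists (F :&: h @^-1: half_cube i b); split; last exact: subsetIl.
  by apply: half_face_of_dim => //; apply: hC; apply: half_cube_face.
rewrite subsetI SF; apply/subsetP => v vS.
by rewrite inE (subsetP Sib) // imset_f.
Qed.

Lemma card_proper_face k F S :
  face_of_dim K k.+1 F -> S \in faces K -> S \proper F -> #|S| <= 2 ^ k.
Proof.
move=> Fk SK SF; have [->|Sn0] := eqVneq S set0; first by rewrite cards0.
have [R [/card_face <- SR _]] := proper_face_sub_ridge Fk SK Sn0 SF.
exact: subset_leq_card.
Qed.

Lemma crossing_ridges k F : face_of_dim K k.+2 F ->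
  exists R0 R1 Q,
    [/\ face_of_dim K k.+1 R0, face_of_dim K k.+1 R1 & face_of_dim K k.+1 Q]
    /\ [/\ R0 \subset F, R1 \subset F & Q \subset F]
    /\ [/\ R0 :&: R1 = set0, Q :&: R0 != set0 & Q :&: R1 != set0].
Proof.
move=> Fk; have [h [hinj hF hC hG]] := face_coordinates Fk.
pose r i b := F :&: h @^-1: half_cube i b.
have rk i b : face_of_dim K k.+1 (r i b).
  by apply: half_face_of_dim => //; apply: hC; apply: half_cube_face.
have meets b : r ord_max true :&: r ord0 b != set0.
  (* The point with coordinate [b] at [ord0] and [true] elsewhere; dimension at least 2 makes
     [ord_max] differ from [ord0]. *)
  have : [ffun i : 'I_k.+2 => (i == ord0) ==> b] \in h @: F by rewrite hF inE.
  case/imsetP => v vF hv; apply/set0Pn; exists v.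
  by rewrite !inE vF -hv !ffunE !eqxx.
exists (r ord0 true), (r ord0 false), (r ord_max true).
split; first by split.
split; first by split; apply: subsetIl.
split=> //; apply/setP => v; rewrite !inE.
by case: (v \in F) => //=; case: (h v ord0).
Qed.

(** Choose a vertex in each pairwise intersection: every one of the three faces contains two of the
    chosen vertices, hence their majority. *)
Lemma face_helly F A B C :
  F \in faces K -> A \in faces K -> B \in faces K -> C \in faces K ->
  A \subset F -> B \subset F -> C \subset F ->
  A :&: B != set0 -> A :&: C != set0 -> B :&: C != set0 ->
  A :&: B :&: C != set0.
Proof.
move=> FK AK BK CK AF BF CF /set0Pn[x /setIP[xA xB]] /set0Pn[y /setIP[yA yC]].
move=> /set0Pn[z /setIP[zB zC]].
have [k Fk] : exists k, face_of_dim K k F.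
  by apply: cube_face => //; apply/set0Pn; exists x; apply: (subsetP AF).
have [h [hinj hF _ hG]] := face_coordinates Fk.
have : majority (h x) (h y) (h z) \in h @: F by rewrite hF inE.
case/imsetP => v vF hv.
have pull G : G \in faces K -> G \subset F ->
    [|| (x \in G) && (y \in G), (x \in G) && (z \in G)
      | (y \in G) && (z \in G)] -> v \in G.
  move=> GK GF two.
  suff : h v \in h @: G.
    by case/imsetP => u uG huv; rewrite (hinj v u) // (subsetP GF).
  rewrite -hv; apply: majority_cube_face; first exact: hG.
  by case/or3P: two => /andP[uG wG];
    rewrite (imset_f h uG) (imset_f h wG) ?orbT.
apply/set0Pn; exists v; rewrite !inE.
by rewrite (pull A) ?xA ?yA // (pull B) ?xB ?zB ?orbT // (pull C) ?yC ?zC ?orbT.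
Qed.

(** * Facets and vertex counts in a pseudomanifold *)

Lemma facet_face F : F \in facets K -> F \in faces K.
Proof. by rewrite inE => /maxsetp. Qed.

Lemma facets_meet_proper F G : F \in facets K -> G \in facets K -> F != G ->
  F :&: G \proper F.
Proof.
move=> Ff Gf FG; rewrite properEneq subsetIl andbT.
apply: contraNneq FG => /setIidPl sFG.
by move: Ff; rewrite inE => /maxsetP[_ /(_ _ (facet_face Gf) sFG)] ->.
Qed.

Lemma facet_exists : exists F, F \in facets K.
Proof.
have [F Fmax _] := @maxset_exists _ (fun G => G \in faces K) _ (empty_face K).
by exists F; rewrite inE.
Qed.

Section Pseudomanifold.

Variable k : nat.
Hypothesis Kpm : cubical_pseudomanifold K k.+2.

Let facet_dim F : F \in facets K -> face_of_dim K k.+2 F.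
Proof. by case: Kpm => pureK _; apply: pureK. Qed.

Lemma card_facets_meet F G : F \in facets K -> G \in facets K -> F != G ->
  #|F :&: G| <= 2 ^ k.+1.
Proof.
move=> Ff Gf FG; apply: card_proper_face (facet_dim Ff) _ _.
  by apply: meet_face; apply: facet_face.
exact: facets_meet_proper.
Qed.

(** The second facet through [R] meets [F] in a set containing [R], and two distinct facets share no
    more vertices than a ridge has. *)
Lemma facet_across F R :
  F \in facets K -> face_of_dim K k.+1 R -> R \subset F ->
  exists G, [/\ G \in facets K, G != F & G :&: F = R].
Proof.
move=> Ff Rk RF; have := (proj2 Kpm) R Rk.
rewrite (cardsD1 F) inE Ff RF add1n => -[] /eqP/cards1P[G GE].
have : G \in [set G] by rewrite inE.
rewrite -GE !inE => /and3P[GF Gmax RG].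
have Gf : G \in facets K by rewrite inE.
exists G; split=> //; apply/esym/eqP; rewrite eqEcard subsetI RG RF /=.
by rewrite (card_face Rk) card_facets_meet.
Qed.

Lemma card_disjoint_facets F H : F \in facets K -> H \in facets K ->
  F :&: H = set0 -> 2 ^ k.+3 <= #|V|.
Proof.
move=> Ff Hf FH0; have : #|F :|: H| <= #|V| by apply: max_card.
rewrite cardsU FH0 cards0.
rewrite (card_face (facet_dim Ff)) (card_face (facet_dim Hf)).
by rewrite [2 ^ k.+3]expnS; lia.
Qed.

Lemma card_facets_small_meet F H : F \in facets K -> H \in facets K ->
  F :&: H != set0 -> #|F :&: H| < 2 ^ k.+1 -> 2 ^ k.+3 <= #|V|.
Proof.
move=> Ff Hf Sn0 Ssmall.
have FneqH : F != H.
  apply: contraTneq Ssmall => ->; rewrite setIid -leqNgt.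
  by rewrite (card_face (facet_dim Hf)) leq_exp2l.
have SpH : F :&: H \proper H.
  by rewrite setIC facets_meet_proper // eq_sym.
have [|Q [Qk SQ QH]] := proper_face_sub_ridge (facet_dim Hf) _ Sn0 SpH.
  by apply: meet_face; apply: facet_face.
have [N [Nf NH NHQ]] := facet_across Hf Qk QH.
(* Otherwise [F :&: H] would be the ridge [Q], against its small size. *)
have NneqF : N != F.
  apply: contraTneq Ssmall => NF.
  by rewrite -leqNgt -(card_face Qk) -NHQ NF.
have NFH : N :&: (F :&: H) = F :&: H.
  by apply/setIidPr; apply: subset_trans SQ _; rewrite -NHQ subsetIl.
have cF := card_face (facet_dim Ff).
have cH := card_face (facet_dim Hf).
have cN := card_face (facet_dim Nf).
have cNH := card_face Qk.
have cNF := card_facets_meet Nf Ff NneqF.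
(* With s the size of [F :&: H], the union [F :|: H] has [2 ^ k.+3] - s vertices. It meets [N] in at
   most [2 ^ k.+1] + [2 ^ k.+1] - s of the [2 ^ k.+2] vertices of [N], so [N] adds at least s. *)
have cV : #|N :|: (F :|: H)| <= #|V| by apply: max_card.
have cFH := cardsUI F H.
have cU := cardsUI N (F :|: H).
have cNI := cardsUI (N :&: F) (N :&: H).
rewrite -setIUr -setIIr NFH NHQ in cNI.
have e1 := expnS 2 k.+2; have e2 := expnS 2 k.+1.
lia.
Qed.

Lemma facets_not_all_ridge_meet :
  ~ (forall F H, F \in facets K -> H \in facets K -> F != H ->
       #|F :&: H| = 2 ^ k.+1).
Proof.
move=> meetK; have [F Ff] := facet_exists.
have [R0 [R1 [Q [[R0k R1k Qk] [[R0F R1F QF] [R01 QR0 QR1]]]]]] :=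
  crossing_ridges (facet_dim Ff).
have [G0 [G0f G0F G0R]] := facet_across Ff R0k R0F.
have [G1 [G1f G1F G1R]] := facet_across Ff R1k R1F.
have [N [Nf NF NQ]] := facet_across Ff Qk QF.
have neq_facet A B X Y : A :&: F = X -> B :&: F = Y -> X != Y -> A != B.
  by move=> <- <-; apply: contraNneq => ->.
have R0n0 : R0 != set0 by case: R0k.
have G01 : G0 != G1.
  apply: neq_facet G0R G1R _; apply: contraNneq R0n0 => R0R1.
  by rewrite -R01 -R0R1 setIid.
have QnR0 : Q != R0 by apply: contraNneq QR1 => ->; rewrite R01.
have NG0 : N != G0 by apply: neq_facet NQ G0R _.
have G01F : G0 :&: G1 :&: F = set0 by rewrite setIIl G0R G1R.
have R0G : R0 :&: (G0 :&: G1) = set0.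
  by apply/eqP; rewrite -subset0 -G01F setIC setIS.
(* These two disjoint parts of [G0] each have half of its vertices. *)
have G0E : R0 :|: G0 :&: G1 = G0.
  apply/eqP; rewrite eqEcard subUset -{1}G0R !subsetIl /=.
  have := cardsUI R0 (G0 :&: G1); rewrite R0G cards0 addn0 => ->.
  rewrite (card_face (facet_dim G0f)) (card_face R0k) meetK //.
  by rewrite (expnS _ k.+1) mul2n addnn.
(* If [N] missed [G0 :&: G1], then [N :&: G0] would lie in [R0], hence in [Q :&: R0]; having the
   size of a ridge, it would force [Q = R0]. *)
have NG01 : N :&: (G0 :&: G1) != set0.
  apply: contraNneq QnR0 => NG01.
  have sQ : N :&: G0 \subset Q :&: R0.
    by rewrite -G0E setIUr NG01 setU0 subsetI -NQ setIS ?subsetIr.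
  have cQ := card_face Qk; have cR0 := card_face R0k.
  have QR0Q : Q :&: R0 = Q.
    apply/eqP; rewrite eqEcard subsetIl cQ -(meetK N G0) //.
    exact: subset_leq_card.
  by rewrite eqEcard cQ cR0 leqnn andbT; apply/setIidPl.
have NR R : R \subset F -> Q :&: R != set0 -> N :&: R != set0.
  by move=> /setIidPr FR; rewrite -NQ -setIA FR.
have facesI A B : A \in facets K -> B \in facets K -> A :&: B \in faces K.
  by move=> Af Bf; apply: meet_face; apply: facet_face.
(* The pairwise intersections are [N :&: R0], [N :&: R1] and [N :&: (G0 :&: G1)], whereas a common
   vertex would lie in [F :&: G0 :&: G1], which is empty. *)
have : (N :&: F) :&: (N :&: G0) :&: (N :&: G1) != set0.
  apply: (face_helly (F := N)); rewrite ?subsetIl ?facesI ?facet_face //.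
  - by rewrite -setIIr [F :&: G0]setIC G0R NR.
  - by rewrite -setIIr [F :&: G1]setIC G1R NR.
  - by rewrite -setIIr.
by apply/negP/negPn; rewrite -!setIIr -setIA [F :&: _]setIC G01F setI0.
Qed.

End Pseudomanifold.
End Faces.

Theorem theorem3p2 (V : finType) (K : cubical_complex V) (d : nat) :
  2 <= d -> cubical_pseudomanifold K d -> 2 ^ d.+1 <= #|V|.
Proof.
case: d => [|[|k]] // _ Kpm; rewrite leqNgt; apply/negP => Vsmall.
(* With too few vertices, both counting bounds fail, so any two distinct facets must share exactly
   [2 ^ k.+1] vertices. *)
apply: (facets_not_all_ridge_meet Kpm) => F H Ff Hf FH.
apply/eqP; rewrite eqn_leq (card_facets_meet Kpm) //=.
rewrite leqNgt; apply/negP => meet_small; move: Vsmall; apply/negP.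
rewrite -leqNgt; have [FH0|FHn0] := eqVneq (F :&: H) set0.
  exact: (card_disjoint_facets Kpm Ff Hf).
exact: (card_facets_small_meet Kpm Ff Hf).
Qed.
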